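(* Let $J=J(\{a_j\},\{b_j\},\{c_j\})_{j\in\mathbb N}$ be a semi-infinite Jacobi matrix with $J-J_0\in\mathcal S_1$. Then the operator $J$ on $\ell^2(\mathbb N)$ has no embedded eigenvalues, i.e., no eigenvalues on the interval $(-2,2)$.
   Context: $\mathbb N=\{1,2,\dots\}$. $J=J(\{a_j\},\{b_j\},\{c_j\})_{j\in\mathbb N}$ is the operator on $\ell^2(\mathbb N)$ given by the semi-infinite tridiagonal matrix with diagonal entries $J_{k,k}=b_k$, superdiagonal entries $J_{k,k+1}=c_k$ and subdiagonal entries $J_{k+1,k}=a_k$, $k\ge1$, where $a_k,b_k,c_k$ are uniformly bounded complex numbers and $a_kc_k\ne0$ for all $k\in\mathbb N$. $J_0=J(\{1\},\{0\},\{1\})$ is the discrete Laplacian on the half-line, with spectrum $[-2,2]$. $\mathcal S_1$ is the trace class; $J-J_0\in\mathcal S_1$ is equivalent to $\sum_{n\ge1}(|1-a_n|+|b_n|+|1-c_n|)<\infty$. *)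

(* Defs.v *)
From Stdlib Require Import Reals Arith.
From Coquelicot Require Import Coquelicot.

Open Scope R_scope.

                                                                    
                                                                             
                                                          

Definition in_l2 (x : nat -> C) : Prop :=
  ex_series (fun n => Cmod (x n) ^ 2).

Definition l2_norm (x : nat -> C) : R :=
  sqrt (Series (fun n => Cmod (x n) ^ 2)).

                                                                            
                          
Definition l2_inner (x y : nat -> C) : C :=
  (Series (fun n => Re (x n * Cconj (y n))%C),
   Series (fun n => Im (x n * Cconj (y n))%C)).

Definition orthonormal (u : nat -> nat -> C) : Prop :=
  (forall n, in_l2 (u n)) /\
  (forall m n, l2_inner (u m) (u n) = RtoC (if Nat.eqb m n then 1 else 0)).

                                                                     
                                                                        
                                                                        
                                                                     
                           
Definition trace_class (T : (nat -> C) -> nat -> C) : Prop :=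
  exists (s : nat -> R) (u v : nat -> nat -> C),
    (forall n, 0 <= s n) /\ ex_series s /\
    orthonormal u /\ orthonormal v /\
    forall x, in_l2 x ->
      in_l2 (T x) /\
      is_lim_seq
        (fun N => l2_norm (fun k =>
           (T x k - sum_n (fun n => s n * l2_inner x (u n) * v n k)%C N)%C))
        0.

                                                                              
                                    
Definition jacobi (a b c : nat -> C) (x : nat -> C) (n : nat) : C :=
  (match n with O => 0 | S m => a m * x m end + b n * x n + c n * x (S n))%C.

Definition free_jacobi : (nat -> C) -> nat -> C :=
  jacobi (fun _ => RtoC 1) (fun _ => RtoC 0) (fun _ => RtoC 1).

Definition op_sub (S T : (nat -> C) -> nat -> C) (x : nat -> C) (n : nat) : C :=
  (S x n - T x n)%C.

Definition bounded_seq (a : nat -> C) : Prop :=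
  exists M : R, forall n, Cmod (a n) <= M.

Definition is_eigenvalue (T : (nat -> C) -> nat -> C) (lam : C) : Prop :=
  exists x : nat -> C,
    in_l2 x /\ (exists n, x n <> RtoC 0) /\ (forall n, T x n = (lam * x n)%C).

(* Main.v *)
Require Import Defs.
From Stdlib Require Import Reals Arith Lra Lia.
From Coquelicot Require Import Coquelicot.
Open Scope R_scope.

(** The free equation [x (n+2) + x n = lam * x (n+1)] conserves the quadratic
    form [energy lam (x n) (x (n+1))], which is positive definite exactly when
    [-2 < lam < 2].  An eigenvector of [J] solves this equation up to an error
    [r n] whose size is at most [eps n] times the neighbouring entries of [x],
    where [eps n] collects the deviations of the coefficients from those of
    [J_0].  Since the change of energy in one step is
    [Re (Cconj (x (n+2) - x n) * r n)], it is bounded relative to the energy by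
    a multiple of [eps n] ([energy_step_le]).  When [eps] is summable, relative
    changes of this size can only reduce the energy by a bounded factor
    ([summable_variation_not_lim_0]), so the energy stays away from zero; but for
    a square-summable vector it must tend to zero.  The energy is never zero to
    begin with, because two consecutive zeros of an eigenvector propagate in
    both directions through the nonzero off-diagonal entries
    ([consecutive_zeros]).

    Summability of [eps] is what the trace class gives.  In a singular value
    expansion [sum_n s n <., u n> v n], the entries along a diagonal are at most
    [sum_n s n |u n (k+p)| |v n (k+q)|], and summing over [k] first gives at most
    [sum_n s n] because [u n] and [v n] are unit vectors
    ([trace_class_diagonal]). *)

(** * Real series *)

Lemma sum_n_S (f : nat -> R) n : sum_n f (S n) = sum_n f n + f (S n) :> R.
Proof. exact (sum_Sn f n). Qed.

Lemma sum_n_le (f g : nat -> R) N :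
  (forall n, f n <= g n) -> sum_n f N <= sum_n g N.
Proof. intros H; apply sum_n_m_le; exact H. Qed.

Lemma sum_n_le_Series (f : nat -> R) N :
  (forall n, 0 <= f n) -> ex_series f -> sum_n f N <= Series f.
Proof.
  intros Hf Hs.
  apply (is_lim_seq_incr_compare (sum_n f)).
  - exact (Series_correct f Hs).
  - intros n; rewrite sum_n_S; specialize (Hf (S n)); lra.
Qed.

Lemma sum_n_shift_le_Series (f : nat -> R) p N :
  (forall n, 0 <= f n) -> ex_series f ->
  sum_n (fun k => f (k + p)%nat) N <= Series f.
Proof.
  intros Hf Hs.
  apply Rle_trans with (sum_n f (N + p)); [|now apply sum_n_le_Series].
  induction N as [|N IH].
  - rewrite sum_O; simpl.
    destruct p as [|p]; [rewrite sum_O; lra|].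
    rewrite sum_n_S.
    assert (0 <= sum_n f p); [|lra].
    clear -Hf; induction p as [|p IH]; [rewrite sum_O; apply Hf|].
    rewrite sum_n_S; specialize (Hf (S p)); lra.
  - change (S N + p)%nat with (S (N + p)).
    rewrite !sum_n_S; change (S N + p)%nat with (S (N + p)); lra.
Qed.

Lemma ex_series_bounded (f : nat -> R) M :
  (forall n, 0 <= f n) -> (forall N, sum_n f N <= M) -> ex_series f.
Proof.
  intros Hf HM.
  destruct (ex_finite_lim_seq_incr (sum_n f) M) as [l Hl].
  - intros n; rewrite sum_n_S; specialize (Hf (S n)); lra.
  - exact HM.
  - exists l; exact Hl.
Qed.

Lemma is_series_single (f : nat -> R) j :
  (forall n, n <> j -> f n = 0) -> is_series f (f j).
Proof.
  intros Hf.
  assert (Hlt : forall n, (n < j)%nat -> sum_n f n = 0 :> R).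
  { induction n as [|n IH]; intros Hn; [rewrite sum_O; apply Hf; lia|].
    rewrite sum_n_S, IH, Hf by lia; ring. }
  assert (Hge : forall n, (j <= n)%nat -> sum_n f n = f j :> R).
  { induction n as [|n IH]; intros Hn.
    - replace j with 0%nat by lia; apply sum_O.
    - rewrite sum_n_S; destruct (Nat.eq_dec j (S n)) as [->|Hj].
      + rewrite Hlt by lia; ring.
      + rewrite IH, (Hf (S n)) by lia; ring. }
  apply (is_lim_seq_ext_loc (fun _ => f j) (sum_n f) (f j)).
  - exists j; intros n Hn; symmetry; auto.
  - apply is_lim_seq_const.
Qed.

(** The hypothesis gives [E (n+1) >= (1 - 2 * t n) * E n], and a product of
    factors [1 - 2 * t n] over a tail on which the [t n] sum to at most [1/4]
    is at least [1/2]. *)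
Lemma summable_variation_not_lim_0 (E t : nat -> R) :
  (forall n, 0 < E n) -> (forall n, 0 <= t n) -> ex_series t ->
  (forall n, Rabs (E (S n) - E n) <= t n * (E n + E (S n))) ->
  ~ is_lim_seq E 0.
Proof.
  intros HE Ht Hs Hstep Hlim.
  assert (Hstep' : forall n, E n * (1 - 2 * t n) <= E (S n)).
  { intros n; specialize (Hstep n); apply Rabs_le_between in Hstep.
    specialize (Ht n); pose proof (HE n) as H0; pose proof (HE (S n)) as H1.
    apply Rmult_le_reg_l with (1 + t n); [lra|].
    assert (0 <= E n * (t n * t n)) by (apply Rmult_le_pos; nra).
    nra. }
  assert (Hsum := Series_correct t Hs).
  change (is_lim_seq (sum_n t) (Series t)) in Hsum.
  apply is_lim_seq_spec in Hsum.
  destruct (Hsum (mkposreal (1/4) ltac:(lra))) as [N HN].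
  specialize (HN N (Nat.le_refl N)); simpl in HN.
  apply Rabs_lt_between in HN.
  assert (Hmono : forall k, sum_n t N <= sum_n t (N + k)).
  { induction k as [|k IH]; [rewrite Nat.add_0_r; lra|].
    rewrite Nat.add_succ_r, sum_n_S; specialize (Ht (S (N + k))); lra. }
  assert (Htail : forall k, sum_n t (N + k) - sum_n t N <= 1/4).
  { intros k; pose proof (sum_n_le_Series t (N + k) Ht Hs); lra. }
  assert (Hlow : forall k,
    E (S N) * (1 - 2 * (sum_n t (N + k) - sum_n t N)) <= E (S (N + k))).
  { induction k as [|k IH]; [rewrite Nat.add_0_r; lra|].
    pose proof (Htail (S k)) as Hk; pose proof (Hmono k) as Hm.
    specialize (Hstep' (S (N + k))).
    rewrite Nat.add_succ_r in *; rewrite sum_n_S in *.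
    pose proof (Ht (S (N + k))) as Htk.
    pose proof (HE (S N)) as HEN.
    set (tau := t (S (N + k))) in *.
    set (d := sum_n t (N + k) - sum_n t N) in *.
    replace (sum_n t (N + k) + tau - sum_n t N) with (d + tau) in *
      by (unfold d; ring).
    apply Rle_trans with (2 := Hstep').
    apply Rle_trans with (E (S N) * (1 - 2 * d) * (1 - 2 * tau)).
    - assert (0 <= d * tau) by (apply Rmult_le_pos; unfold d; lra).
      nra.
    - apply Rmult_le_compat_r; [unfold d in *; lra|exact IH]. }
  apply is_lim_seq_spec in Hlim.
  pose proof (HE (S N)) as HEN.
  destruct (Hlim (mkposreal (E (S N) / 2) ltac:(lra))) as [N' HN'].
  specialize (HN' (S (N + N')) ltac:(lia)); simpl in HN'.
  apply Rabs_lt_between in HN'.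
  specialize (Hlow N'); specialize (Htail N'); nra.
Qed.

(** * The sequence space *)

Lemma Cmod_le_l2_norm (x : nat -> C) k : in_l2 x -> Cmod (x k) <= l2_norm x.
Proof.
  intros Hx; unfold l2_norm.
  rewrite <- (sqrt_pow2 (Cmod (x k))) by apply Cmod_ge_0.
  apply sqrt_le_1_alt.
  pose proof (sum_n_shift_le_Series (fun n => Cmod (x n) ^ 2) k 0
    (fun n => pow2_ge_0 _) Hx) as H.
  rewrite sum_O in H; exact H.
Qed.

Lemma in_l2_scal (z : C) x : in_l2 x -> in_l2 (fun k => z * x k)%C.
Proof.
  intros Hx; unfold in_l2.
  apply ex_series_ext with (fun n => Cmod z ^ 2 * Cmod (x n) ^ 2).
  - intros n; rewrite Cmod_mult; simpl; ring.
  - exact (ex_series_scal_l (Cmod z ^ 2) _ Hx).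
Qed.

Lemma in_l2_plus x y : in_l2 x -> in_l2 y -> in_l2 (fun k => x k + y k)%C.
Proof.
  intros Hx Hy; unfold in_l2.
  apply (ex_series_le (fun n => Cmod (x n + y n)%C ^ 2)
           (fun n => 2 * Cmod (x n) ^ 2 + 2 * Cmod (y n) ^ 2)).
  - intros n; unfold norm; simpl.
    rewrite Rabs_pos_eq by apply (pow2_ge_0 (Cmod _)).
    pose proof (Cmod_triangle (x n) (y n)).
    pose proof (Cmod_ge_0 (x n + y n)%C).
    pose proof (pow2_ge_0 (Cmod (x n) - Cmod (y n))).
    nra.
  - exact (ex_series_plus _ _ (ex_series_scal_l 2 _ Hx) (ex_series_scal_l 2 _ Hy)).
Qed.

Lemma in_l2_sum (f : nat -> nat -> C) N :
  (forall n, in_l2 (f n)) -> in_l2 (fun k => sum_n (fun n => f n k) N).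
Proof.
  intros Hf; induction N as [|N IH].
  - apply ex_series_ext with (2 := Hf 0%nat); intros k; rewrite sum_O; reflexivity.
  - apply ex_series_ext with (2 := in_l2_plus _ _ IH (Hf (S N))).
    intros k; rewrite sum_Sn; reflexivity.
Qed.

Lemma Cmod_sum_n_le (f : nat -> C) N :
  Cmod (sum_n f N) <= sum_n (fun n => Cmod (f n)) N.
Proof.
  induction N as [|N IH]; [rewrite !sum_O; lra|].
  rewrite sum_n_S, sum_Sn.
  eapply Rle_trans; [apply Cmod_triangle|]; lra.
Qed.

Lemma orthonormal_Series (u : nat -> nat -> C) n :
  orthonormal u -> Series (fun k => Cmod (u n k) ^ 2) = 1.
Proof.
  intros [_ Hu]; specialize (Hu n n); rewrite Nat.eqb_refl in Hu.
  apply (f_equal fst) in Hu; simpl in Hu; rewrite <- Hu.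
  apply Series_ext; intros k; rewrite Cmod2_alt; unfold Re, Im; simpl; ring.
Qed.

Definition basis (j n : nat) : C := if Nat.eqb n j then RtoC 1 else RtoC 0.

Lemma in_l2_basis j : in_l2 (basis j).
Proof.
  eexists; apply (is_series_single (fun n => Cmod (basis j n) ^ 2) j).
  intros n Hn; unfold basis; apply Nat.eqb_neq in Hn; rewrite Hn, Cmod_0; ring.
Qed.

Lemma l2_inner_basis j y : l2_inner (basis j) y = Cconj (y j).
Proof.
  assert (H0 : forall n, n <> j -> (basis j n * Cconj (y n))%C = RtoC 0).
  { intros n Hn; unfold basis; apply Nat.eqb_neq in Hn; rewrite Hn; ring. }
  assert (H1 : (basis j j * Cconj (y j))%C = Cconj (y j)).
  { unfold basis; rewrite Nat.eqb_refl; ring. }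
  unfold l2_inner.
  rewrite (is_series_unique _ _
    (is_series_single (fun n => Re (basis j n * Cconj (y n))%C) j
      ltac:(intros n Hn; cbv beta; rewrite (H0 n Hn); reflexivity))).
  rewrite (is_series_unique _ _
    (is_series_single (fun n => Im (basis j n * Cconj (y n))%C) j
      ltac:(intros n Hn; cbv beta; rewrite (H0 n Hn); reflexivity))).
  rewrite H1; reflexivity.
Qed.

(** * Matrix entries of trace class operators *)

(** Exchanging the two sums leaves, for each [n], the sum over [k] of
    [|u n (k+p)| |v n (k+q)|], which is at most 1 by the inequality between
    arithmetic and geometric means. *)
Lemma singular_diagonal_le (s : nat -> R) (u v : nat -> nat -> C) p q N K :
  (forall n, 0 <= s n) -> ex_series s -> orthonormal u -> orthonormal v ->
  sum_n (fun k => Cmod (sum_n (fun n =>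
    (s n * l2_inner (basis (k + p)) (u n) * v n (k + q)%nat)%C) N)) K
  <= Series s.
Proof.
  intros Hs0 Hs Hu Hv.
  apply Rle_trans with (sum_n (fun k => sum_n (fun n =>
    s n * (/2 * Cmod (u n (k + p)%nat) ^ 2 + /2 * Cmod (v n (k + q)%nat) ^ 2)) N) K).
  - apply sum_n_le; intros k.
    eapply Rle_trans; [apply Cmod_sum_n_le|].
    apply sum_n_le; intros n.
    rewrite l2_inner_basis, !Cmod_mult, Cmod_conj, Cmod_R, (Rabs_pos_eq _ (Hs0 n)).
    rewrite Rmult_assoc; apply Rmult_le_compat_l; [apply Hs0|].
    pose proof (pow2_ge_0 (Cmod (u n (k + p)%nat) - Cmod (v n (k + q)%nat))); lra.
  - rewrite sum_n_switch.
    apply Rle_trans with (sum_n s N); [|now apply sum_n_le_Series].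
    apply sum_n_le; intros n.
    rewrite (sum_n_mult_l (K := R_Ring) (s n)).
    rewrite (sum_n_plus (G := R_AbelianMonoid)
      (fun k => /2 * Cmod (u n (k + p)%nat) ^ 2)
      (fun k => /2 * Cmod (v n (k + q)%nat) ^ 2)).
    rewrite (sum_n_mult_l (K := R_Ring) (/2) (fun k => Cmod (u n (k + p)%nat) ^ 2)).
    rewrite (sum_n_mult_l (K := R_Ring) (/2) (fun k => Cmod (v n (k + q)%nat) ^ 2)).
    pose proof (sum_n_shift_le_Series (fun k => Cmod (u n k) ^ 2) p K
      (fun k => pow2_ge_0 _) (proj1 Hu n)) as H1.
    pose proof (sum_n_shift_le_Series (fun k => Cmod (v n k) ^ 2) q K
      (fun k => pow2_ge_0 _) (proj1 Hv n)) as H2.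
    rewrite orthonormal_Series in H1, H2 by assumption.
    assert (Hmean : forall A B, A <= 1 -> B <= 1 ->
                    s n * (/2 * A + /2 * B) <= s n)
      by (intros A B HA HB; specialize (Hs0 n); nra).
    exact (Hmean _ _ H1 H2).
Qed.

(** The bound for the partial expansions passes to the limit, since convergence
    in norm implies convergence of each entry. *)
Lemma trace_class_diagonal T p q :
  trace_class T -> ex_series (fun k => Cmod (T (basis (k + p)) (k + q)%nat)).
Proof.
  intros (s & u & v & Hs0 & Hs & Hu & Hv & HT).
  apply ex_series_bounded with (Series s); [intros; apply Cmod_ge_0|intros K].
  set (P := fun N k => sum_n (fun n =>
    (s n * l2_inner (basis (k + p)) (u n) * v n (k + q)%nat)%C) N).
  set (D := fun N k => Cmod (T (basis (k + p)) (k + q)%nat - P N k)%C).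
  assert (HD : forall k, is_lim_seq (fun N => D N k) 0).
  { intros k; destruct (HT _ (in_l2_basis (k + p))) as [Hin Hlim].
    apply is_lim_seq_le_le with (u := fun _ => 0) (3 := Hlim);
      [intros N; split; [apply Cmod_ge_0|]|apply is_lim_seq_const].
    apply (Cmod_le_l2_norm (fun i => (T (basis (k + p)) i - sum_n (fun n =>
      (s n * l2_inner (basis (k + p)) (u n) * v n i)%C) N)%C) (k + q)).
    apply ex_series_ext with (2 := in_l2_plus _ _ Hin
      (in_l2_scal (-1)%C _ (in_l2_sum
        (fun n i => (s n * l2_inner (basis (k + p)) (u n) * v n i)%C) N
        (fun n => in_l2_scal _ _ (proj1 Hv n))))).
    intros i; do 2 f_equal; ring. }
  assert (HDK : is_lim_seq (fun N => sum_n (D N) K) 0).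
  { induction K as [|K IH].
    - apply is_lim_seq_ext with (2 := HD 0%nat); intros N; rewrite sum_O; reflexivity.
    - apply is_lim_seq_ext with (fun N => sum_n (D N) K + D N (S K)).
      + intros N; rewrite sum_n_S; reflexivity.
      + replace (Finite 0) with (Rbar_plus 0 0) by (simpl; f_equal; ring).
        apply is_lim_seq_plus'; [exact IH|apply HD]. }
  assert (Hle : Rbar_le (sum_n (fun k => Cmod (T (basis (k + p)) (k + q)%nat)) K)
                        (0 + Series s)).
  { apply is_lim_seq_le with
      (u := fun _ => sum_n (fun k => Cmod (T (basis (k + p)) (k + q)%nat)) K)
      (v := fun N => sum_n (D N) K + Series s).
    - intros N.
      apply Rle_trans with (sum_n (D N) K + sum_n (fun k => Cmod (P N k)) K).
      + rewrite <- (sum_n_plus (G := R_AbelianMonoid) (D N) (fun k => Cmod (P N k))).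
        apply sum_n_le; intros k; unfold plus; simpl; unfold D.
        eapply Rle_trans; [|apply Cmod_triangle].
        right; f_equal; ring.
      + apply Rplus_le_compat_l; apply singular_diagonal_le; assumption.
    - apply is_lim_seq_const.
    - apply is_lim_seq_plus'; [exact HDK|apply is_lim_seq_const]. }
  simpl in Hle; lra.
Qed.

(** Row [n+1] of [J - J_0] has [a n - 1], [b (n+1)] and [c (n+1) - 1] in columns
    [n], [n+1] and [n+2].  These are grouped by row because together they are
    the error in the recurrence linking three consecutive eigenvector entries. *)
Lemma jacobi_trace_class_summable a b c :
  trace_class (op_sub (jacobi a b c) free_jacobi) ->
  ex_series (fun n => Cmod (1 - a n)%C + Cmod (b (S n)) + Cmod (1 - c (S n))%C).
Proof.
  intros HJ.
  assert (Hdiag := fun p => trace_class_diagonal _ p 1 HJ).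
  apply (ex_series_plus (fun n => Cmod (1 - a n)%C + Cmod (b (S n)))
           (fun n => Cmod (1 - c (S n))%C));
    [apply (ex_series_plus (fun n => Cmod (1 - a n)%C) (fun n => Cmod (b (S n))))|].
  1: apply ex_series_ext with (2 := Hdiag 0%nat).
  2: apply ex_series_ext with (2 := Hdiag 1%nat).
  3: apply ex_series_ext with (2 := Hdiag 2%nat).
  all: intros n; unfold op_sub, free_jacobi, jacobi, basis;
    rewrite Nat.add_1_r, ?Nat.add_0_r, ?Nat.add_1_r;
    replace (n + 2)%nat with (S (S n)) by lia.
  - rewrite Nat.eqb_refl, (proj2 (Nat.eqb_neq (S n) n)),
      (proj2 (Nat.eqb_neq (S (S n)) n)) by lia.
    rewrite <- (Cmod_opp (1 - a n)%C); f_equal; ring.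
  - rewrite Nat.eqb_refl, (proj2 (Nat.eqb_neq n (S n))),
      (proj2 (Nat.eqb_neq (S (S n)) (S n))) by lia.
    f_equal; ring.
  - rewrite Nat.eqb_refl, (proj2 (Nat.eqb_neq n (S (S n)))),
      (proj2 (Nat.eqb_neq (S n) (S (S n)))) by lia.
    rewrite <- (Cmod_opp (1 - c (S n))%C); f_equal; ring.
Qed.

(** * The energy *)

Definition energy (lam : R) (x y : C) : R :=
  Cmod x ^ 2 + Cmod y ^ 2 - lam * Re (x * Cconj y)%C.

Lemma energy_lower lam x y :
  (1 - Rabs lam / 2) * (Cmod x ^ 2 + Cmod y ^ 2) <= energy lam x y.
Proof.
  unfold energy.
  pose proof (re_le_Cmod (x * Cconj y)%C) as H.
  rewrite Cmod_mult, Cmod_conj in H.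
  pose proof (pow2_ge_0 (Cmod x - Cmod y)).
  pose proof (Rabs_pos lam) as Hl.
  assert (lam * Re (x * Cconj y)%C
          <= Rabs lam * ((Cmod x ^ 2 + Cmod y ^ 2) / 2)); [|lra].
  apply Rle_trans with (1 := Rle_abs _); rewrite Rabs_mult.
  apply Rmult_le_compat_l; [exact Hl|lra].
Qed.

Lemma energy_upper lam x y :
  energy lam x y <= (1 + Rabs lam / 2) * (Cmod x ^ 2 + Cmod y ^ 2).
Proof.
  pose proof (energy_lower (- lam) x y) as H.
  rewrite Rabs_Ropp in H; unfold energy in *; lra.
Qed.

(** Discrete analogue of multiplying the equation by the derivative of its
    solution; it makes the conservation law for the free equation visible. *)
Lemma energy_step lam x y z :
  energy lam y z - energy lam x y
  = Re (Cconj (z - x) * (z + x - lam * y))%C.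
Proof.
  unfold energy; rewrite !Cmod2_alt.
  destruct x, y, z; unfold Re, Im; simpl; ring.
Qed.

Lemma energy_step_le lam (al be ga x y z : C) :
  -2 < lam < 2 ->
  (al * x + be * y + ga * z = lam * y)%C ->
  Rabs (energy lam y z - energy lam x y)
  <= 3 / (1 - Rabs lam / 2) * (Cmod (1 - al)%C + Cmod be + Cmod (1 - ga)%C)
     * (energy lam x y + energy lam y z).
Proof.
  intros Hlam Heq.
  assert (Hk : 0 < 1 - Rabs lam / 2).
  { assert (Rabs lam < 2) by (apply Rabs_def1; lra); lra. }
  set (eps := Cmod (1 - al)%C + Cmod be + Cmod (1 - ga)%C).
  pose proof (Cmod_ge_0 (1 - al)%C); pose proof (Cmod_ge_0 be);
    pose proof (Cmod_ge_0 (1 - ga)%C).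
  pose proof (Cmod_ge_0 x); pose proof (Cmod_ge_0 y); pose proof (Cmod_ge_0 z).
  assert (Heps : 0 <= eps) by (unfold eps; lra).
  rewrite energy_step.
  replace (z + x - lam * y)%C with ((1 - al) * x + (- be) * y + (1 - ga) * z)%C
    by (rewrite <- Heq; ring).
  eapply Rle_trans; [apply re_le_Cmod|].
  rewrite Cmod_mult, Cmod_conj.
  assert (Hr : Cmod ((1 - al) * x + (- be) * y + (1 - ga) * z)%C
               <= eps * (Cmod x + Cmod y + Cmod z)).
  { eapply Rle_trans; [apply Cmod_triangle|].
    eapply Rle_trans; [apply Rplus_le_compat_r, Cmod_triangle|].
    rewrite !Cmod_mult, Cmod_opp; unfold eps; nra. }
  assert (Hd : Cmod (z - x)%C <= Cmod x + Cmod z).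
  { unfold Cminus; eapply Rle_trans; [apply Cmod_triangle|]; rewrite Cmod_opp; lra. }
  apply Rle_trans with
    ((Cmod x + Cmod z) * (eps * (Cmod x + Cmod y + Cmod z))).
  { apply Rmult_le_compat; auto using Cmod_ge_0. }
  pose proof (energy_lower lam x y); pose proof (energy_lower lam y z).
  set (k := 1 - Rabs lam / 2) in *.
  (* The middle entry gets the weight 2 because it occurs in both energies; the
     constant 3 leaves room in (|x| + |z|)(|x| + |y| + |z|), expanded with
     2|x||z| <= |x|^2 + |z|^2 and its analogues. *)
  apply Rle_trans with (eps * (3 * (Cmod x ^ 2 + 2 * Cmod y ^ 2 + Cmod z ^ 2))).
  - rewrite <- Rmult_assoc, (Rmult_comm _ eps), Rmult_assoc.
    apply Rmult_le_compat_l; [exact Heps|].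
    pose proof (pow2_ge_0 (Cmod x - Cmod z)).
    pose proof (pow2_ge_0 (Cmod x - Cmod y)).
    pose proof (pow2_ge_0 (Cmod z - Cmod y)).
    nra.
  - replace (3 / k * eps * (energy lam x y + energy lam y z))
      with (eps * (3 * ((energy lam x y + energy lam y z) / k))) by (field; lra).
    apply Rmult_le_compat_l; [exact Heps|].
    apply Rmult_le_compat_l; [lra|].
    apply Rmult_le_reg_l with k; [exact Hk|].
    replace (k * ((energy lam x y + energy lam y z) / k))
      with (energy lam x y + energy lam y z) by (field; lra).
    lra.
Qed.

(** * Eigenvectors *)

Lemma Cmult_eq_0_r (z w : C) : z <> RtoC 0 -> (z * w)%C = RtoC 0 -> w = RtoC 0.
Proof.
  intros Hz H; apply Cmod_eq_0.
  apply (f_equal Cmod) in H; rewrite Cmod_mult, Cmod_0 in H.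
  apply Rmult_integral in H as [H|H]; [|exact H].
  apply Cmod_eq_0 in H; contradiction.
Qed.

(** Zeros travel down to the indices 0 and 1 through the subdiagonal entries,
    and from there up through the superdiagonal ones. *)
Lemma consecutive_zeros a b c (lam : C) (x : nat -> C) m :
  (forall n, (a n * c n)%C <> RtoC 0) ->
  (forall n, jacobi a b c x n = (lam * x n)%C) ->
  x m = RtoC 0 -> x (S m) = RtoC 0 -> forall n, x n = RtoC 0.
Proof.
  intros Hac Heq Hm HSm.
  assert (Ha : forall n, a n <> RtoC 0).
  { intros n H; apply (Hac n); rewrite H; ring. }
  assert (Hc : forall n, c n <> RtoC 0).
  { intros n H; apply (Hac n); rewrite H; ring. }
  assert (H01 : x 0%nat = RtoC 0 /\ x 1%nat = RtoC 0).
  { induction m as [|m IH]; [now split|].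
    apply IH; [|exact Hm].
    apply Cmult_eq_0_r with (1 := Ha m).
    specialize (Heq (S m)); unfold jacobi in Heq; rewrite Hm, HSm in Heq.
    transitivity (a m * x m + b (S m) * 0 + c (S m) * 0)%C; [ring|].
    rewrite Heq; ring. }
  assert (Hall : forall n, x n = RtoC 0 /\ x (S n) = RtoC 0); [|apply Hall].
  induction n as [|n [IH0 IH1]]; [exact H01|split; [exact IH1|]].
  apply Cmult_eq_0_r with (1 := Hc (S n)).
  specialize (Heq (S n)); unfold jacobi in Heq; rewrite IH0, IH1 in Heq.
  transitivity (a n * 0 + b (S n) * 0 + c (S n) * x (S (S n)))%C; [ring|].
  rewrite Heq; ring.
Qed.

Theorem corollary2p2 (a b c : nat -> C)
  (ha : bounded_seq a) (hb : bounded_seq b) (hc : bounded_seq c)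
  (hac : forall n : nat, (a n * c n)%C <> RtoC 0)
  (hJ : trace_class (op_sub (jacobi a b c) free_jacobi)) :
  forall lam : R, -2 < lam < 2 -> ~ is_eigenvalue (jacobi a b c) (RtoC lam).
Proof.
  intros lam Hlam (x & Hx & [m Hm] & Heq).
  assert (Hk : 0 < 1 - Rabs lam / 2).
  { assert (Rabs lam < 2) by (apply Rabs_def1; lra); lra. }
  set (E := fun n => energy lam (x n) (x (S n))).
  set (eps := fun n => Cmod (1 - a n)%C + Cmod (b (S n)) + Cmod (1 - c (S n))%C).
  assert (HE : forall n, (1 - Rabs lam / 2) * (Cmod (x n) ^ 2 + Cmod (x (S n)) ^ 2)
                         <= E n) by (intros n; apply energy_lower).
  apply (summable_variation_not_lim_0 E (fun n => 3 / (1 - Rabs lam / 2) * eps n)).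
  - intros n; apply Rlt_le_trans with (2 := HE n).
    apply Rmult_lt_0_compat; [exact Hk|].
    pose proof (pow2_ge_0 (Cmod (x n))) as H0.
    pose proof (pow2_ge_0 (Cmod (x (S n)))) as H1.
    apply Rnot_le_lt; intros Hle; apply Hm.
    apply (consecutive_zeros a b c lam x n hac Heq);
      apply Cmod_eq_0; apply Rsqr_0_uniq; unfold Rsqr; lra.
  - intros n; apply Rmult_le_pos.
    + apply Rlt_le, Rdiv_lt_0_compat; lra.
    + unfold eps; pose proof (Cmod_ge_0 (1 - a n)%C);
        pose proof (Cmod_ge_0 (b (S n))); pose proof (Cmod_ge_0 (1 - c (S n))%C); lra.
  - apply (ex_series_scal_l (3 / (1 - Rabs lam / 2)) eps).
    exact (jacobi_trace_class_summable a b c hJ).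
  - intros n; apply energy_step_le; [exact Hlam|exact (Heq (S n))].
  - assert (H0 := ex_series_lim_0 _ Hx).
    assert (H1 := proj1 (is_lim_seq_incr_1 _ _) H0).
    apply is_lim_seq_le_le with (u := fun _ => 0)
      (w := fun n => (1 + Rabs lam / 2) * (Cmod (x n) ^ 2 + Cmod (x (S n)) ^ 2)).
    + intros n; split; [|apply energy_upper].
      apply Rle_trans with (2 := HE n).
      apply Rmult_le_pos; [lra|].
      apply Rplus_le_le_0_compat; apply pow2_ge_0.
    + apply is_lim_seq_const.
    + replace (Finite 0) with (Rbar_mult (1 + Rabs lam / 2) (0 + 0))
        by (simpl; f_equal; ring).
      apply is_lim_seq_scal_l, is_lim_seq_plus'; assumption.
Qed.
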